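(* Put $N:=\{1,\ldots,6\}$, $P:=\{X\subseteq N\mid|X\cap\{1,2,3\}|=|X\cap\{4,5,6\}|\}$, $X':=N\setminus X$ for $X\in P$, and let $\mathbf P=(P,\subseteq,{}',\emptyset,N)$ (a twenty-element orthomodular poset). Put $Q:=\{A\in P\mid |A|=2\}$ and for every $A\in Q$ put $P_A:=\{B\in P\mid B\supseteq A\text{ or }B\subseteq A'\}$. Moreover, define binary operations $\vee$ and $\wedge$ on $P_A$ as follows, for $B,C\in P_A$: $B\vee C:=B\cup C$ if $|B\cup C|$ is even and $B\vee C:=B\cup C\cup A'$ otherwise; $B\wedge C:=B\cap C$ if $|B\cap C|$ is even and $B\wedge C:=B\cap C\cap A$ otherwise. Then $\mathbf P_A:=(P_A,\vee,\wedge,{}',\emptyset,N)$, $A\in Q$, are nine pairwise distinct twelve-element maximal orthomodular sublattices of $\mathbf P$, each of which is the atomic pasting of two eight-element Boolean algebras via the atom $A$.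
   Context: An orthoposet is a tuple $(P,\leq,{}',0,1)$ where $(P,\leq,0,1)$ is a bounded poset and ${}'$ is a unary operation on $P$ such that $x\leq y$ implies $y'\leq x'$, $x''=x$, and for every $x$ the supremum $x\vee x'$ exists and equals $1$ and the infimum $x\wedge x'$ exists and equals $0$. Elements $x,y$ are orthogonal, $x\perp y$, if $x\leq y'$. An orthomodular poset is an orthoposet in which the supremum $x\vee y$ exists whenever $x\perp y$ and in which $x\leq y$ implies $x\vee(x\vee y')'=y$; an orthomodular lattice is an orthomodular poset that is a lattice. An orthomodular sublattice of an orthomodular poset $\mathbf P$ is a subset $S\subseteq P$ with $0,1\in S$, closed under ${}'$ and under suprema (taken in $\mathbf P$) of orthogonal elements, such that $S$ with the induced order is a lattice, the lattice operations being those of the induced order of $S$ (they need not be suprema and infima in $\mathbf P$). With the restricted ${}'$ it is then an orthomodular lattice. It is maximal if it is not properly contained in another orthomodular sublattice of $\mathbf P$. An orthomodular lattice $M$ is the atomic pasting of a family of Boolean algebras $M_i$ ($i\in I$) via the atom $p$ if the $M_i$ are Boolean subalgebras of $M$ (with the same $0,1,{}',\vee,\wedge$), $p$ is an atom of every $M_i$, $M=\bigcup_{i\in I}M_i$, $M_i\cap M_j=\{0,p,p',1\}$ for $i\neq j$, and $x\leq y$ in $M$ if and only if $x\leq y$ in some $M_i$ containing both $x$ and $y$. *)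

(* Defs.v *)
From mathcomp Require Import all_boot.

Set Implicit Arguments.
Unset Strict Implicit.
Unset Printing Implicit Defensive.

(* Structures are given by a carrier inside an ambient finite type T;          *)
(* relations and operations are total on T, but only their values on the       *)
(* carrier matter.                                                             *)

Record ordered_structure (T : finType) := OrderedStructure {
  os_carrier : {set T};
  os_le : rel T;
  os_compl : T -> T;
  os_bot : T;
  os_top : T }.

Record lattice_structure (T : finType) := LatticeStructure {
  ls_carrier : {set T};
  ls_join : T -> T -> T;
  ls_meet : T -> T -> T;
  ls_compl : T -> T;
  ls_bot : T;
  ls_top : T }.

(* s is the supremum (infimum) of x and y computed in the subset S *)
Definition is_sup (T : finType) (le : rel T) (S : {set T}) (x y s : T) : Prop :=
  [/\ s \in S, le x s, le y s
    & {in S, forall u, le x u -> le y u -> le s u}].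

Definition is_inf (T : finType) (le : rel T) (S : {set T}) (x y s : T) : Prop :=
  [/\ s \in S, le s x, le s y
    & {in S, forall u, le u x -> le u y -> le u s}].

Definition bounded_poset (T : finType) (P : ordered_structure T) : Prop :=
  [/\ {in os_carrier P, reflexive (os_le P)},
      {in os_carrier P &, antisymmetric (os_le P)},
      {in os_carrier P & &, transitive (os_le P)},
      os_bot P \in os_carrier P /\ {in os_carrier P, forall x, os_le P (os_bot P) x}
    & os_top P \in os_carrier P /\ {in os_carrier P, forall x, os_le P x (os_top P)}].

Definition orthoposet (T : finType) (P : ordered_structure T) : Prop :=
  bounded_poset P /\
  [/\ {in os_carrier P, forall x, os_compl P x \in os_carrier P},
      {in os_carrier P &, forall x y,
         os_le P x y -> os_le P (os_compl P y) (os_compl P x)},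
      {in os_carrier P, forall x, os_compl P (os_compl P x) = x},
      {in os_carrier P, forall x,
         is_sup (os_le P) (os_carrier P) x (os_compl P x) (os_top P)}
    & {in os_carrier P, forall x,
         is_inf (os_le P) (os_carrier P) x (os_compl P x) (os_bot P)}].

Definition orthogonal (T : finType) (P : ordered_structure T) (x y : T) : bool :=
  os_le P x (os_compl P y).

(* In the last clause s stands for the supremum of x and y', which exists by   *)
(* the previous clause; the conclusion says that x \/ s' exists and equals y.  *)
Definition orthomodular_poset (T : finType) (P : ordered_structure T) : Prop :=
  [/\ orthoposet P,
      {in os_carrier P &, forall x y, orthogonal P x y ->
         exists s, is_sup (os_le P) (os_carrier P) x y s}
    & {in os_carrier P &, forall x y, os_le P x y ->
         forall s, is_sup (os_le P) (os_carrier P) x (os_compl P y) s ->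
         is_sup (os_le P) (os_carrier P) x (os_compl P s) y}].

Definition orthomodular_sublattice (T : finType) (P : ordered_structure T)
    (S : {set T}) : Prop :=
  [/\ S \subset os_carrier P,
      os_bot P \in S /\ os_top P \in S,
      {in S, forall x, os_compl P x \in S},
      {in S &, forall x y, orthogonal P x y ->
         forall s, is_sup (os_le P) (os_carrier P) x y s -> s \in S}
    & {in S &, forall x y, (exists s, is_sup (os_le P) S x y s) /\
                           (exists s, is_inf (os_le P) S x y s)}].

Definition maximal_orthomodular_sublattice (T : finType)
    (P : ordered_structure T) (S : {set T}) : Prop :=
  orthomodular_sublattice P S /\
  ~ exists S' : {set T}, orthomodular_sublattice P S' /\ S \proper S'.

(* The operations of M are those its carrier inherits from P: the join and     *)
(* meet are the ones of the induced order, not suprema and infima in P.        *)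
Definition induced_operations (T : finType) (P : ordered_structure T)
    (M : lattice_structure T) : Prop :=
  [/\ {in ls_carrier M &, forall x y,
         is_sup (os_le P) (ls_carrier M) x y (ls_join M x y)},
      {in ls_carrier M &, forall x y,
         is_inf (os_le P) (ls_carrier M) x y (ls_meet M x y)},
      {in ls_carrier M, forall x, ls_compl M x = os_compl P x},
      ls_bot M = os_bot P
    & ls_top M = os_top P].

Definition ls_le (T : finType) (M : lattice_structure T) : rel T :=
  fun x y => ls_join M x y == y.

Definition ordered_of_lattice (T : finType) (M : lattice_structure T) :
    ordered_structure T :=
  OrderedStructure (ls_carrier M) (ls_le M) (ls_compl M) (ls_bot M) (ls_top M).

Definition bounded_lattice (T : finType) (M : lattice_structure T) : Prop :=
  [/\ bounded_poset (ordered_of_lattice M),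
      {in ls_carrier M &, forall x y,
         is_sup (ls_le M) (ls_carrier M) x y (ls_join M x y)}
    & {in ls_carrier M &, forall x y,
         is_inf (ls_le M) (ls_carrier M) x y (ls_meet M x y)}].

Definition orthomodular_lattice (T : finType) (M : lattice_structure T) : Prop :=
  bounded_lattice M /\ orthomodular_poset (ordered_of_lattice M).

Definition boolean_algebra (T : finType) (M : lattice_structure T) : Prop :=
  bounded_lattice M /\
  [/\ {in ls_carrier M & &, forall x y z,
         ls_meet M x (ls_join M y z) = ls_join M (ls_meet M x y) (ls_meet M x z)},
      {in ls_carrier M, forall x, ls_compl M x \in ls_carrier M},
      {in ls_carrier M, forall x, ls_join M x (ls_compl M x) = ls_top M}
    & {in ls_carrier M, forall x, ls_meet M x (ls_compl M x) = ls_bot M}].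

Definition restrict (T : finType) (M : lattice_structure T) (B : {set T}) :
    lattice_structure T :=
  LatticeStructure B (ls_join M) (ls_meet M) (ls_compl M) (ls_bot M) (ls_top M).

(* closure of B under the operations of M is part of boolean_algebra *)
Definition boolean_subalgebra (T : finType) (M : lattice_structure T)
    (B : {set T}) : Prop :=
  B \subset ls_carrier M /\ boolean_algebra (restrict M B).

Definition is_atom (T : finType) (M : lattice_structure T) (p : T) : Prop :=
  [/\ p \in ls_carrier M, p != ls_bot M
    & {in ls_carrier M, forall x, ls_le M x p -> x = ls_bot M \/ x = p}].

Definition atomic_pasting (T : finType) (M : lattice_structure T)
    (I : Type) (B : I -> {set T}) (p : T) : Prop :=
  orthomodular_lattice M /\
  [/\ forall i, boolean_subalgebra M (B i),
      forall i, is_atom (restrict M (B i)) p,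
      forall x, x \in ls_carrier M <-> exists i, x \in B i,
      forall i j, i <> j ->
        B i :&: B j = [set ls_bot M; p; ls_compl M p; ls_top M]
    & {in ls_carrier M &, forall x y,
         ls_le M x y <->
         exists i, [/\ x \in B i, y \in B i & ls_le (restrict M (B i)) x y]}].

(* The ordinal i : 'I_6 stands for the element i + 1 of N = {1,...,6}, so that *)
(* {1,2,3} is [set i | i < 3].                                                 *)
Definition balanced_sets : {set {set 'I_6}} :=
  [set X : {set 'I_6} |
    #|X :&: [set i : 'I_6 | i < 3]| == #|X :&: [set i : 'I_6 | 3 <= i]|].

Definition balanced_poset : ordered_structure {set 'I_6} :=
  OrderedStructure balanced_sets (fun X Y => X \subset Y) (fun X => ~: X)
    set0 setT.

Definition Q : {set {set 'I_6}} := [set A in balanced_sets | #|A| == 2].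

Definition P_carrier (A : {set 'I_6}) : {set {set 'I_6}} :=
  [set B in balanced_sets | (A \subset B) || (B \subset ~: A)].

Definition P_join (A B C : {set 'I_6}) : {set 'I_6} :=
  if odd #|B :|: C| then B :|: C :|: ~: A else B :|: C.

Definition P_meet (A B C : {set 'I_6}) : {set 'I_6} :=
  if odd #|B :&: C| then B :&: C :&: A else B :&: C.

Definition P_lattice (A : {set 'I_6}) : lattice_structure {set 'I_6} :=
  LatticeStructure (P_carrier A) (P_join A) (P_meet A) (fun X => ~: X)
    set0 setT.

(* Main.v *)
Require Import Defs.
From mathcomp Require Import all_boot.

(* Any family of subsets of a set which contains the empty set and is closed
   under complements and disjoint unions is an orthomodular poset; this applies
   to P and to every P_A.  For C in Q disjoint from A, the elements of P_A that
   also lie in P_C form an eight-element field of sets with atom A, on which the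
   operations of P_A are union and intersection; the two perfect matchings
   between {1,2,3} \ A and {4,5,6} \ A give the two blocks.  P_A is maximal
   because, for X in P outside P_A and Y the two-element set among X and X',
   the sets A and Y have two upper bounds in P_A with no balanced set between
   them.  The facts specific to six points are checked by computation on
   characteristic bit sequences. *)

Set Implicit Arguments.
Unset Strict Implicit.
Unset Printing Implicit Defensive.

(** * Concrete orthomodular posets of sets *)

Section ConcreteFamily.

(** The order is abstract and agrees with inclusion only on [S], so that [le] can be inclusion
    itself or the order [ls_le] derived from a join, which is inclusion only on suitable sets. *)
Variables (U : finType) (S : {set {set U}}) (le : rel {set U}).
Hypothesis leE : {in S &, forall x y : {set U}, le x y = (x \subset y)}.
Hypotheses (S0 : set0 \in S) (S1 : setT \in S).

Lemma concrete_bounded_poset (c : {set U} -> {set U}) :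
  bounded_poset (OrderedStructure S le c set0 setT).
Proof.
split=> /=.
- by move=> x xS; rewrite leE.
- by move=> x y xS yS; rewrite !leE // => xy; apply/eqP; rewrite eqEsubset.
- by move=> y x z yS xS zS; rewrite !leE //; apply: subset_trans.
- by split=> // x xS; rewrite leE // sub0set.
by split=> // x xS; rewrite leE // subsetT.
Qed.

Lemma is_sup_subset x y (s : {set U}) : x \in S -> y \in S ->
  is_sup le S x y s <-> is_sup (fun X Y : {set U} => X \subset Y) S x y s.
Proof.
move=> xS yS; split=> -[sS xs ys least]; split=> //; rewrite ?leE // -?leE //.
- by move=> u uS; rewrite -!leE //; apply: least.
- by move=> u uS; rewrite !leE //; apply: least.
Qed.

Lemma is_inf_subset x y (s : {set U}) : x \in S -> y \in S ->
  is_inf le S x y s <-> is_inf (fun X Y : {set U} => X \subset Y) S x y s.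
Proof.
move=> xS yS; split=> -[sS xs ys least]; split=> //; rewrite ?leE // -?leE //.
- by move=> u uS; rewrite -!leE //; apply: least.
- by move=> u uS; rewrite !leE //; apply: least.
Qed.

Lemma concrete_sup_setU x y :
  x \in S -> y \in S -> x :|: y \in S -> is_sup le S x y (x :|: y).
Proof.
move=> xS yS xyS; apply/is_sup_subset => //; split=> //.
- exact: subsetUl.
- exact: subsetUr.
by move=> u uS xu yu; rewrite subUset xu.
Qed.

Lemma concrete_inf_setI x y :
  x \in S -> y \in S -> x :&: y \in S -> is_inf le S x y (x :&: y).
Proof.
move=> xS yS xyS; apply/is_inf_subset => //; split=> //.
- exact: subsetIl.
- exact: subsetIr.
by move=> u uS ux uy; rewrite subsetI ux.
Qed.

Lemma concrete_sup_unique x y s t : x \in S -> y \in S ->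
  is_sup le S x y s -> is_sup le S x y t -> s = t.
Proof.
move=> xS yS /is_sup_subset [] // sS xs ys leS /is_sup_subset [] // tS xt yt leT.
by apply/eqP; rewrite eqEsubset leS // leT.
Qed.

Hypothesis SC : {in S, forall x : {set U}, ~: x \in S}.
Hypothesis SU : {in S &, forall x y : {set U}, [disjoint x & y] -> x :|: y \in S}.

(** On [S] orthogonality is disjointness, so orthogonal suprema are unions. If [x] is contained in
    [y], then [x] and [~: y] are disjoint, and the orthomodular law reduces to writing [y] as the
    union of [x] and the difference of [y] and [x]. *)
Lemma concrete_orthomodular_poset :
  orthomodular_poset (OrderedStructure S le (fun x => ~: x) set0 setT).
Proof.
have leC x y : x \in S -> y \in S -> le x (~: y) = [disjoint x & y].
  by move=> xS yS; rewrite leE ?SC // subsets_disjoint setCK.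
split=> /=.
- split; first exact: concrete_bounded_poset.
  split=> //=.
  + by move=> x y xS yS; rewrite !leE ?SC // setCS.
  + by move=> x xS; rewrite setCK.
  + move=> x xS; rewrite -(setUCr x); apply: concrete_sup_setU; rewrite ?SC //.
    by rewrite setUCr.
  + move=> x xS; rewrite -(setICr x); apply: concrete_inf_setI; rewrite ?SC //.
    by rewrite setICr.
- move=> x y xS yS; rewrite /orthogonal /= leC // => xy.
  by exists (x :|: y); apply: concrete_sup_setU => //; apply: SU.
move=> x y xS yS; rewrite leE // => xy s sup_s.
have xCy : x :|: ~: y \in S.
  by apply: SU; rewrite ?SC // -subsets_disjoint.
have -> : s = x :|: ~: y.
  apply: (concrete_sup_unique xS _ sup_s); rewrite ?SC //.
  by apply: concrete_sup_setU; rewrite ?SC.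
have Dy : y = x :|: ~: (x :|: ~: y).
  by rewrite setCU setCK setUIr setUCr setTI (setUidPr xy).
rewrite {2}Dy; apply: concrete_sup_setU; rewrite -?Dy ?SC //.
Qed.

End ConcreteFamily.

(** * Subsets of {1,...,6} as bit sequences *)

Fixpoint bitseqs n : seq bitseq :=
  if n is n'.+1 then [seq b :: s | b <- [:: true; false], s <- bitseqs n']
  else [:: [::]].

Lemma mem_bitseqs n s : (s \in bitseqs n) = (size s == n).
Proof.
elim: n s => [|n IHn] [|b s] //.
  by apply/allpairsP => -[[c t] /= [_ _]].
rewrite eqSS -IHn; apply/allpairsP/idP => [[[c t] /= [_ tn [_ ->]]] //|sn].
by exists (b, s); split=> //; case: b.
Qed.

(** Characteristic sequence of [X]; statements quantified over sets become finite checks over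
    [bitseqs 6] for [vm_compute]. *)
Definition enc (X : {set 'I_6}) : bitseq := [seq i \in X | i <- enum 'I_6].

Lemma enc_inj : injective enc.
Proof.
move=> X Y /eq_in_map XY; apply/setP => i.
by apply: XY; rewrite mem_enum.
Qed.

Lemma enc_set (p : pred nat) : enc [set i : 'I_6 | p i] = [seq p i | i <- iota 0 6].
Proof.
by rewrite -val_enum_ord -map_comp; apply: eq_map => i; rewrite inE.
Qed.

Lemma enc_surj s : s \in bitseqs 6 -> exists X, enc X = s.
Proof.
(* The default [false] is never reached, since [i < 6 = size s]. *)
rewrite mem_bitseqs => /eqP s6; exists [set i : 'I_6 | nth false s i].
by rewrite enc_set -s6; apply: mkseq_nth.
Qed.

Lemma enc_mem (X : {set 'I_6}) : enc X \in bitseqs 6.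
Proof. by rewrite mem_bitseqs size_map size_enum_ord. Qed.

Definition bimage2 (op : bool -> bool -> bool) (s t : bitseq) : bitseq :=
  [seq op p.1 p.2 | p <- zip s t].

Definition bsub (s t : bitseq) := all id (bimage2 implb s t).

Lemma enc_setU (X Y : {set 'I_6}) : enc (X :|: Y) = bimage2 orb (enc X) (enc Y).
Proof. by rewrite /bimage2 zip_map -map_comp; apply: eq_map => i; rewrite inE. Qed.

Lemma enc_setI (X Y : {set 'I_6}) : enc (X :&: Y) = bimage2 andb (enc X) (enc Y).
Proof. by rewrite /bimage2 zip_map -map_comp; apply: eq_map => i; rewrite inE. Qed.

Lemma enc_setC (X : {set 'I_6}) : enc (~: X) = map negb (enc X).
Proof. by rewrite -map_comp; apply: eq_map => i; rewrite inE. Qed.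

Lemma enc_subset (X Y : {set 'I_6}) : (X \subset Y) = bsub (enc X) (enc Y).
Proof.
rewrite /bsub /bimage2 zip_map -map_comp all_map.
apply/subsetP/allP => [XY i _ /=|XY i].
  by apply/implyP; apply: XY.
by apply/implyP; apply: XY; rewrite mem_enum.
Qed.

Lemma enc_card (X : {set 'I_6}) : #|X| = count id (enc X).
Proof. by rewrite count_map cardE -size_filter [in LHS]/enum_mem -enumT. Qed.

(** [enc] is a bijection onto [bitseqs 6], so the encodings of the members of [S] are, up to order,
    the entries satisfying [p]. *)
Lemma card_enc (S : {set {set 'I_6}}) (p : pred bitseq) :
  (forall X, (X \in S) = p (enc X)) -> #|S| = count p (bitseqs 6).
Proof.
move=> Sp; rewrite cardE -size_filter -(size_map enc); apply: perm_size.
apply: uniq_perm => [||s].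
- by rewrite (map_inj_uniq enc_inj) enum_uniq.
- by apply: filter_uniq; vm_compute.
rewrite mem_filter; apply/mapP/andP => [[X] | [ps /enc_surj[X Xs]]].
  by rewrite mem_enum Sp => pX ->; split=> //; apply: enc_mem.
by exists X; rewrite ?mem_enum ?Sp Xs.
Qed.

(** The two literals encode {1,2,3} and {4,5,6}. *)
Definition bbalanced (s : bitseq) :=
  count id (bimage2 andb s [:: true; true; true; false; false; false]) ==
  count id (bimage2 andb s [:: false; false; false; true; true; true]).

Lemma enc_balanced (X : {set 'I_6}) : (X \in balanced_sets) = bbalanced (enc X).
Proof.
by rewrite inE !enc_card !enc_setI (enc_set (fun i => i < 3)) (enc_set (leq 3)).
Qed.

Definition balanced_bitseqs := filter bbalanced (bitseqs 6).

Lemma enc_balanced_mem X : X \in balanced_sets -> enc X \in balanced_bitseqs.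
Proof. by rewrite mem_filter enc_balanced enc_mem => ->. Qed.

Definition bQ (s : bitseq) := bbalanced s && (count id s == 2).

Lemma enc_Q (X : {set 'I_6}) : (X \in Q) = bQ (enc X).
Proof. by rewrite inE enc_balanced enc_card. Qed.

Definition bP (a s : bitseq) := bbalanced s && (bsub a s || bsub s (map negb a)).

Lemma enc_P (A X : {set 'I_6}) : (X \in P_carrier A) = bP (enc A) (enc X).
Proof. by rewrite inE enc_balanced !enc_subset enc_setC. Qed.

Definition bjoin (a s t : bitseq) :=
  let u := bimage2 orb s t in
  if odd (count id u) then bimage2 orb u (map negb a) else u.

Lemma enc_join (A X Y : {set 'I_6}) :
  enc (P_join A X Y) = bjoin (enc A) (enc X) (enc Y).
Proof.
rewrite /P_join /bjoin enc_card -enc_setU.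
by case: ifP => _; rewrite !enc_setU ?enc_setC.
Qed.

(** * The poset and its subsets P_A *)

Lemma balanced_set0 : set0 \in balanced_sets.
Proof. by rewrite inE !set0I. Qed.

Lemma balanced_setC :
  {in balanced_sets, forall X : {set 'I_6}, ~: X \in balanced_sets}.
Proof.
have check : all (fun s => bbalanced (map negb s)) balanced_bitseqs by vm_compute.
move=> X /enc_balanced_mem/(allP check).
by rewrite enc_balanced enc_setC.
Qed.

Lemma balanced_setT : setT \in balanced_sets.
Proof. by rewrite -setC0 balanced_setC ?balanced_set0. Qed.

Lemma balanced_setU :
  {in balanced_sets &, forall X Y : {set 'I_6},
     [disjoint X & Y] -> X :|: Y \in balanced_sets}.
Proof.
move=> X Y; rewrite !inE => /eqP X1 /eqP Y1 XY.
have dis (Z : {set 'I_6}) : #|(X :|: Y) :&: Z| = #|X :&: Z| + #|Y :&: Z|.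
  rewrite setIUl cardsU [_ :&: _ :&: _](_ : _ = set0) ?cards0 ?subn0 //.
  by rewrite setIACA (disjoint_setI0 XY) set0I.
by rewrite !dis X1 Y1.
Qed.

(** Both halves contribute the same number of points. Hence a balanced union always falls in the
    even case of [P_join]. *)
Lemma balanced_even (X : {set 'I_6}) : X \in balanced_sets -> ~~ odd #|X|.
Proof.
have check : all (fun s => ~~ odd (count id s)) balanced_bitseqs by vm_compute.
by move/enc_balanced_mem/(allP check); rewrite enc_card.
Qed.

Lemma P_join_balanced (A X Y : {set 'I_6}) :
  X :|: Y \in balanced_sets -> P_join A X Y = X :|: Y.
Proof. by move/balanced_even; rewrite /P_join => /negbTE->. Qed.

Lemma P_meetE (A X Y : {set 'I_6}) : P_meet A X Y = ~: P_join A (~: X) (~: Y).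
Proof.
have D : ~: X :|: ~: Y = ~: (X :&: Y) by rewrite setCI.
rewrite /P_join D /P_meet -[in odd #|X :&: Y|](setCK (X :&: Y)).
(* As 6 is even, a set and its complement have the same parity, so meet and dual join take the same
   branch. *)
have := cardsC (~: (X :&: Y)); rewrite card_ord => /(congr1 odd).
rewrite oddD /=; case: (odd #|~: ~: _|); case: (odd _) => // _.
  by rewrite setCU !setCK.
by rewrite setCK.
Qed.

Lemma P_leE (A X Y : {set 'I_6}) : Y \in balanced_sets ->
  ls_le (P_lattice A) X Y = (X \subset Y).
Proof.
move=> Yb; apply/eqP/idP => /= [<-|XY].
  by rewrite /P_join; case: ifP => _; rewrite -?setUA subsetUl.
by rewrite P_join_balanced (setUidPr XY).
Qed.

Lemma P_balanced (A X : {set 'I_6}) : X \in P_carrier A -> X \in balanced_sets.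
Proof. by rewrite inE => /andP[]. Qed.

Lemma P_set0 (A : {set 'I_6}) : set0 \in P_carrier A.
Proof. by rewrite inE balanced_set0 sub0set orbT. Qed.

Lemma P_setT (A : {set 'I_6}) : setT \in P_carrier A.
Proof. by rewrite inE balanced_setT subsetT. Qed.

Lemma P_setC (A : {set 'I_6}) :
  {in P_carrier A, forall X : {set 'I_6}, ~: X \in P_carrier A}.
Proof.
move=> X; rewrite ![_ \in P_carrier _]inE => /andP[Xb AX].
by rewrite balanced_setC // setCS orbC -subsetC.
Qed.

Lemma P_setU (A : {set 'I_6}) :
  {in P_carrier A &, forall X Y : {set 'I_6},
     [disjoint X & Y] -> X :|: Y \in P_carrier A}.
Proof.
move=> X Y; rewrite ![_ \in P_carrier _]inE => /andP[Xb AX] /andP[Yb AY] XY.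
rewrite balanced_setU //= subUset; case/orP: AX => [AX|->].
  by rewrite (subset_trans AX) ?subsetUl.
by case/orP: AY => [AY|->]; rewrite ?orbT // (subset_trans AY) ?subsetUr.
Qed.

(** * Joins, meets and cardinality of the sets P_A *)

Definition Q_bitseqs := filter bQ (bitseqs 6).
Definition P_bitseqs a := filter (bP a) (bitseqs 6).

Lemma enc_Q_mem A : A \in Q -> enc A \in Q_bitseqs.
Proof. by rewrite mem_filter enc_mem enc_Q => ->. Qed.

Lemma enc_Q_surj s : s \in Q_bitseqs -> exists2 A, A \in Q & enc A = s.
Proof.
by rewrite mem_filter => /andP[Qs /enc_surj[A As]]; exists A; rewrite ?enc_Q As.
Qed.

Lemma enc_P_mem A X : X \in P_carrier A -> enc X \in P_bitseqs (enc A).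
Proof. by rewrite mem_filter enc_mem enc_P => ->. Qed.

Lemma enc_P_surj A s :
  s \in P_bitseqs (enc A) -> exists2 X, X \in P_carrier A & enc X = s.
Proof.
by rewrite mem_filter => /andP[Ps /enc_surj[X Xs]]; exists X; rewrite ?enc_P Xs.
Qed.

(** A member of P_A contains [A] or misses it, and its trace on A' is balanced. So an odd union has
    exactly three points in A', and every upper bound in P_A must contain all of A'. The proof
    checks all cases. *)
Lemma P_join_sup (A X Y : {set 'I_6}) :
  A \in Q -> X \in P_carrier A -> Y \in P_carrier A ->
  is_sup (fun B C : {set 'I_6} => B \subset C) (P_carrier A) X Y (P_join A X Y).
Proof.
move=> AQ XP YP.
have [check_bound check_least] :
  (all (fun a => all (fun x => all (fun y =>
     let s := bjoin a x y in [&& bP a s, bsub x s & bsub y s])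
   (P_bitseqs a)) (P_bitseqs a)) Q_bitseqs) /\
  (all (fun a => all (fun x => all (fun y => all (fun u =>
     bsub x u ==> bsub y u ==> bsub (bjoin a x y) u)
   (P_bitseqs a)) (P_bitseqs a)) (P_bitseqs a)) Q_bitseqs).
  by split; vm_compute.
have [[eA eX] eY] := (enc_Q_mem AQ, enc_P_mem XP, enc_P_mem YP).
have /and3P[] := allP (allP (allP check_bound _ eA) _ eX) _ eY.
have := allP (allP (allP check_least _ eA) _ eX) _ eY.
rewrite -enc_join -!enc_subset -enc_P => {check_bound check_least} least sP Xs Ys.
split=> // Z ZP XZ YZ; have := allP least _ (enc_P_mem ZP).
by rewrite -!enc_subset XZ YZ.
Qed.

Lemma P_meet_inf (A X Y : {set 'I_6}) :
  A \in Q -> X \in P_carrier A -> Y \in P_carrier A ->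
  is_inf (fun B C : {set 'I_6} => B \subset C) (P_carrier A) X Y (P_meet A X Y).
Proof.
move=> AQ XP YP; have [sP Xs Ys least] := P_join_sup AQ (P_setC XP) (P_setC YP).
rewrite P_meetE; split; first exact: P_setC.
- by rewrite -setCS setCK.
- by rewrite -setCS setCK.
by move=> Z ZP ZX ZY; rewrite -setCS setCK; apply: least; rewrite ?P_setC ?setCS.
Qed.

(** [A] can be recovered from P_A as its only two-element member disjoint from all its other
    two-element members; here all pairs are compared by computation. *)
Lemma P_carrier_inj : {in Q &, injective P_carrier}.
Proof.
move=> A B AQ BQ PAB.
have check : all (fun a => all (fun b =>
    all (fun x => bP a x == bP b x) (bitseqs 6) ==> (a == b)) Q_bitseqs) Q_bitseqs.
  by vm_compute.
apply: enc_inj; apply/eqP.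
apply: (implyP (allP (allP check _ (enc_Q_mem AQ)) _ (enc_Q_mem BQ))).
by apply/allP => _ /enc_surj[X <-]; rewrite -!enc_P PAB.
Qed.

(** The members are the empty set, [A], the four balanced pairs inside A', and the complements of
    these six. *)
Lemma card_P_carrier A : A \in Q -> #|P_carrier A| = 12.
Proof.
have check : all (fun a => count (bP a) (bitseqs 6) == 12) Q_bitseqs.
  by vm_compute.
move/enc_Q_mem/(allP check)/eqP <-; apply: card_enc => X.
exact: enc_P.
Qed.

(** Up to complement, [X] is a pair [Y] sharing exactly one point with [A], so the union of [A] and
    [Y] has three points. Adding either of the two missing points of the half it meets only once
    gives [U] and [V]. A set in between would equal this odd union. *)
Lemma no_sup_outside A X : A \in Q -> X \in balanced_sets -> X \notin P_carrier A ->
  exists Y U V, [/\ Y = X \/ Y = ~: X, U \in P_carrier A, V \in P_carrier A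
    & [/\ A \subset U, Y \subset U, A \subset V, Y \subset V
        & {in balanced_sets, forall s : {set 'I_6},
             ~ [/\ A \subset s, Y \subset s, s \subset U & s \subset V]}]].
Proof.
have check : all (fun a => all (fun x => ~~ bP a x ==>
    has (fun y => has (fun u => has (fun v =>
      [&& bsub a u, bsub y u, bsub a v, bsub y v
        & all (fun s => ~~ [&& bsub a s, bsub y s, bsub s u & bsub s v])
            balanced_bitseqs])
    (P_bitseqs a)) (P_bitseqs a)) [:: x; map negb x]) balanced_bitseqs) Q_bitseqs.
  by vm_compute.
move=> AQ Xb; rewrite enc_P => AX.
have {check} := implyP (allP (allP check _ (enc_Q_mem AQ)) _ (enc_balanced_mem Xb)) AX.
case/hasP => y yX /hasP[u /enc_P_surj[U UP <-]] /hasP[v /enc_P_surj[V VP <-]].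
have [Y YX <-] : exists2 Y, Y = X \/ Y = ~: X & enc Y = y.
  move: yX; rewrite !inE -enc_setC.
  by case/orP => /eqP->; [exists X; first left | exists (~: X); first right].
rewrite -!enc_subset => /and5P[AU YU AV YV /allP none].
exists Y, U, V; split=> //; split=> // s sb [As Ys sU sV].
by have := none _ (enc_balanced_mem sb); rewrite -!enc_subset As Ys sU sV.
Qed.

(** * Eight-element Boolean blocks *)

Definition block A C := P_carrier A :&: P_carrier C.

Section Block.

Variables A C : {set 'I_6}.
Hypotheses (AQ : A \in Q) (CQ : C \in Q) (AC : C \subset ~: A).

Lemma Q_carrier B : B \in Q -> B \in P_carrier B.
Proof. by rewrite !inE => /andP[-> _]; rewrite subxx. Qed.

Lemma block_atom : A \in block A C.
Proof.
rewrite inE Q_carrier // inE -subsetC AC orbT andbT.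
by move: AQ; rewrite inE => /andP[].
Qed.

Lemma block_set0 : set0 \in block A C.
Proof. by rewrite inE !P_set0. Qed.

Lemma block_setT : setT \in block A C.
Proof. by rewrite inE !P_setT. Qed.

Lemma block_setC : {in block A C, forall X : {set 'I_6}, ~: X \in block A C}.
Proof. by move=> X /setIP[? ?]; rewrite inE !P_setC. Qed.

(** The block consists of the unions of cells of the partition of the six points into [A], [C] and
    the remaining balanced pair. *)
Lemma block_setU : {in block A C &, forall X Y : {set 'I_6}, X :|: Y \in block A C}.
Proof.
have check : all (fun a => all (fun c => bsub c (map negb a) ==>
    all (fun x => bP c x ==> all (fun y => bP c y ==>
      bP a (bimage2 orb x y) && bP c (bimage2 orb x y))
    (P_bitseqs a)) (P_bitseqs a)) Q_bitseqs) Q_bitseqs.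
  by vm_compute.
move=> X Y /setIP[XA XC] /setIP[YA YC]; rewrite enc_P in XC; rewrite enc_P in YC.
have AC' := AC; rewrite enc_subset enc_setC in AC'.
have := implyP (allP (allP check _ (enc_Q_mem AQ)) _ (enc_Q_mem CQ)) AC'.
move/allP/(_ _ (enc_P_mem XA))/implyP/(_ XC).
move/allP/(_ _ (enc_P_mem YA))/implyP/(_ YC).
by rewrite -enc_setU -!enc_P in_setI.
Qed.

Lemma block_setI : {in block A C &, forall X Y : {set 'I_6}, X :&: Y \in block A C}.
Proof.
move=> X Y Xb Yb; rewrite -[X :&: Y]setCK setCI.
by rewrite block_setC ?block_setU ?block_setC.
Qed.

Lemma block_balanced X : X \in block A C -> X \in balanced_sets.
Proof. by case/setIP => /P_balanced. Qed.

Lemma block_join X Y : X \in block A C -> Y \in block A C ->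
  P_join A X Y = X :|: Y.
Proof. by move=> Xb Yb; rewrite P_join_balanced ?block_balanced ?block_setU. Qed.

Lemma block_meet X Y : X \in block A C -> Y \in block A C ->
  P_meet A X Y = X :&: Y.
Proof.
by move=> Xb Yb; rewrite P_meetE block_join ?block_setC // setCU !setCK.
Qed.

Lemma block_leE : {in block A C &, forall X Y,
  ls_le (restrict (P_lattice A) (block A C)) X Y = (X \subset Y)}.
Proof. by move=> X Y _ /block_balanced; apply: P_leE. Qed.

Lemma block_boolean : boolean_subalgebra (P_lattice A) (block A C).
Proof.
have [[leE b0] b1] := (block_leE, block_set0, block_setT).
split; first exact: subsetIl.
split; first split.
- exact: concrete_bounded_poset.
- move=> X Y Xb Yb /=; rewrite block_join //.
  by apply: concrete_sup_setU => //; apply: block_setU.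
- move=> X Y Xb Yb /=; rewrite block_meet //.
  by apply: concrete_inf_setI => //; apply: block_setI.
split=> /=.
- move=> X Y Z Xb Yb Zb.
  rewrite (block_join Yb) // !block_meet ?block_setU //.
  by rewrite block_join ?block_setI // setIUr.
- exact: block_setC.
- by move=> X Xb; rewrite block_join ?block_setC // setUCr.
- by move=> X Xb; rewrite block_meet ?block_setC // setICr.
Qed.

Lemma block_is_atom : is_atom (restrict (P_lattice A) (block A C)) A.
Proof.
split=> /=; first exact: block_atom.
  by move: AQ; rewrite inE -card_gt0 => /andP[_ /eqP->].
move=> X Xb; rewrite block_leE ?block_atom // => XA.
case/setIP: Xb; rewrite inE => /andP[_ /orP[AX|XCA]] _.
  by right; apply/eqP; rewrite eqEsubset XA.
by left; apply/eqP; rewrite -subset0 -(setICr A) subsetI XA.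
Qed.

Lemma card_block : #|block A C| = 8.
Proof.
have check : all (fun a => all (fun c => bsub c (map negb a) ==>
    (count (fun x => bP a x && bP c x) (bitseqs 6) == 8)) Q_bitseqs) Q_bitseqs.
  by vm_compute.
have AC' := AC; rewrite enc_subset enc_setC in AC'.
rewrite -(eqP (implyP (allP (allP check _ (enc_Q_mem AQ)) _ (enc_Q_mem CQ)) AC')).
by apply: card_enc => X; rewrite in_setI !enc_P.
Qed.

End Block.

(** The four balanced pairs inside A' form two partitions of A'; [C] comes from one and [D] from the
    other. A pair of one partition is not a union of cells for the other, which leaves four common
    members. A pair [K] is properly contained, apart from A' and the whole set, only in the
    complement of its partner, which lies in the same block. *)
Lemma two_blocks A : A \in Q -> exists C D,
  [/\ C \in Q /\ C \subset ~: A, D \in Q /\ D \subset ~: A,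
      block A C :&: block A D = [set set0; A; ~: A; setT]
    & {in P_carrier A &, forall X Y : {set 'I_6}, X \subset Y ->
         (X \in block A C) && (Y \in block A C) ||
         (X \in block A D) && (Y \in block A D)}].
Proof.
have check : all (fun a => has (fun c => has (fun d =>
    [&& bsub c (map negb a), bsub d (map negb a),
      all (fun x => [&& bP a x, bP c x & bP d x] ==
        (x \in [:: nseq 6 false; a; map negb a; nseq 6 true])) (bitseqs 6)
      & all (fun x => all (fun y => bsub x y ==>
          bP c x && bP c y || bP d x && bP d y) (P_bitseqs a)) (P_bitseqs a)])
  Q_bitseqs) Q_bitseqs) Q_bitseqs.
  by vm_compute.
move=> AQ; have {check} /hasP[c /enc_Q_surj[C CQ <-]] := allP check _ (enc_Q_mem AQ).
case/hasP => d /enc_Q_surj[D DQ <-].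
rewrite -!enc_setC -!enc_subset => /and4P[CA DA /allP meetCD /allP cover].
have enc0 : nseq 6 false = enc set0.
  have := enc_set xpred0; rewrite (_ : [set i | _] = set0) => [->//|].
  by apply/setP => i; rewrite !inE.
have encT : nseq 6 true = enc setT by rewrite -setC0 enc_setC -enc0.
exists C, D; split=> //.
  apply/setP => X; have /eqP := meetCD _ (enc_mem X).
  rewrite -!enc_P enc0 encT !in_cons orbF !(inj_eq enc_inj) => HX.
  by rewrite !in_setU !in_set1 -!orbA -HX !in_setI andbACA andbb.
move=> X Y XP YP XY; rewrite !in_setI XP YP /= !enc_P.
apply: (implyP (allP (cover _ (enc_P_mem XP)) _ (enc_P_mem YP))).
by rewrite -enc_subset.
Qed.

(** * Maximality and atomic pasting *)

Lemma P_maximal A :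
  A \in Q -> maximal_orthomodular_sublattice balanced_poset (P_carrier A).
Proof.
move=> AQ; split.
  split=> /=.
  - by apply/subsetP => X /P_balanced.
  - by rewrite P_set0 P_setT.
  - exact: P_setC.
  - move=> X Y XP YP; rewrite /orthogonal /= -disjoints_subset => XY s sup_s.
    have [[Xb Yb] XYP] := (P_balanced XP, P_balanced YP, P_setU XP YP XY).
    suff -> : s = X :|: Y; first exact: XYP.
    apply: (concrete_sup_unique (S := balanced_sets) _ Xb Yb sup_s) => //.
    by apply: concrete_sup_setU => //; apply: P_balanced XYP.
  move=> X Y XP YP; split.
    by exists (P_join A X Y); apply: P_join_sup.
  by exists (P_meet A X Y); apply: P_meet_inf.
case=> S [[/subsetP Sb _ SC _ SL] /properP[/subsetP PS [X XS XP]]].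
have [Y [U [V [YX UP VP [AU YU AV YV none]]]]] := no_sup_outside AQ (Sb _ XS) XP.
have YS : Y \in S by case: YX => ->; rewrite // SC.
(* A supremum of [A] and [Y] in [S] would be a balanced set below both upper bounds [U] and [V],
   which [none] excludes. *)
have [[s [/= sS As Ys least]] _] := SL _ _ (PS _ (Q_carrier AQ)) YS.
by apply: (none s (Sb _ sS)); split=> //; apply: least => //; apply: PS.
Qed.

Lemma P_orthomodular A : A \in Q -> orthomodular_lattice (P_lattice A).
Proof.
move=> AQ; have [P0 P1] := (P_set0 A, P_setT A).
have leE : {in P_carrier A &, forall X Y : {set 'I_6},
    ls_le (P_lattice A) X Y = (X \subset Y)}.
  by move=> X Y _ /P_balanced; apply: P_leE.
split; last exact: concrete_orthomodular_poset leE P0 P1 (@P_setC A) (@P_setU A).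
split=> /=; first exact: concrete_bounded_poset.
  by move=> X Y XP YP; apply/(is_sup_subset leE) => //; apply: P_join_sup.
by move=> X Y XP YP; apply/(is_inf_subset leE) => //; apply: P_meet_inf.
Qed.

Lemma P_pasting A : A \in Q ->
  exists B : 'I_2 -> {set {set 'I_6}},
    (forall i, #|B i| = 8) /\ atomic_pasting (P_lattice A) B A.
Proof.
move=> AQ; have [C [D [[CQ CA] [DQ DA] meetCD cover]]] := two_blocks AQ.
pose B (i : 'I_2) := block A (if i == ord0 then C else D).
have BP i : exists2 E, E \in Q /\ E \subset ~: A & B i = block A E.
  by rewrite /B; case: ifP => _; [exists C | exists D].
have subB i : {subset B i <= P_carrier A} by move=> X /setIP[].
(* Used with [Y] equal to [X], this shows that the blocks cover P_A; in general it gives the order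
   clause of the pasting. *)
have coverB : {in P_carrier A &, forall X Y : {set 'I_6},
    X \subset Y -> exists i, X \in B i /\ Y \in B i}.
  move=> X Y XP YP /cover => /(_ XP YP) /orP[/andP[Xb Yb]|/andP[Xb Yb]].
    by exists ord0.
  by exists ord_max.
exists B; split=> [i|]; first by have [E [EQ EA] ->] := BP i; apply: card_block.
split; first exact: P_orthomodular.
split=> /=.
- by move=> i; have [E [EQ EA] ->] := BP i; apply: block_boolean.
- by move=> i; have [E [EQ EA] ->] := BP i; apply: block_is_atom.
- move=> X; split=> [XP | [i /subB] //].
  by have [i [XB _]] := coverB _ _ XP XP (subxx X); exists i.
- move=> i j /eqP; rewrite -(inj_eq val_inj) /B -!(inj_eq val_inj) /=.
  case: i j => [[|[|//]] ?] [[|[|//]] ?] //= _.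
  by rewrite setIC.
(* Restriction to a block leaves [ls_le] unchanged, so only the forward direction has to find a
   block. *)
move=> X Y XP YP; split=> [XY | [i [_ _]] //].
have := XY; rewrite (P_leE _ _ (P_balanced YP)) => /(coverB _ _ XP YP)[i [XB YB]].
by exists i.
Qed.

Theorem proposition5p5 :
  [/\ orthomodular_poset balanced_poset,
      #|os_carrier balanced_poset| = 20,
      #|Q| = 9,
      {in Q &, injective P_carrier}
    & {in Q, forall A : {set 'I_6},
        [/\ #|P_carrier A| = 12,
            maximal_orthomodular_sublattice balanced_poset (P_carrier A),
            induced_operations balanced_poset (P_lattice A)
          & exists B : 'I_2 -> {set {set 'I_6}},
              (forall i, #|B i| = 8) /\ atomic_pasting (P_lattice A) B A]}].
Proof.
split.
- apply: concrete_orthomodular_poset => //.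
  + exact: balanced_set0.
  + exact: balanced_setT.
  + exact: balanced_setC.
  + exact: balanced_setU.
- by rewrite (card_enc enc_balanced); vm_compute.
- by rewrite (card_enc enc_Q); vm_compute.
- exact: P_carrier_inj.
move=> A AQ; split.
- exact: card_P_carrier.
- exact: P_maximal.
- by split=> // X Y XP YP; [apply: P_join_sup | apply: P_meet_inf].
- exact: P_pasting.
Qed.
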